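(* Let $G$ be a connected, countably infinite, locally finite graph containing no one-way infinite bridge. Then $G$ admits a weak nowhere-zero $\mathbb{Z}_6$-flow.
   Context: An edge $e$ of an infinite connected graph $G$ is a bridge if $G-e$ is disconnected. A bridge is two-way infinite if both components of $G-e$ are infinite, and one-way infinite otherwise (i.e. if one of the two components of $G-e$ is finite). Let $G$ be a locally finite graph with a fixed orientation, and let $A$ be an abelian group. For a vertex $v$, let $\delta^+(v)$ and $\delta^-(v)$ denote the sets of edges directed away from and toward $v$, respectively. A weak $A$-flow is a function $\varphi\colon E(G)\to A$ with $\sum_{e\in\delta^+(v)}\varphi(e)=\sum_{e\in\delta^-(v)}\varphi(e)$ for every $v\in V(G)$. It is nowhere-zero if $\varphi(e)\neq 0$ for all $e\in E(G)$. (Existence of such a flow does not depend on the chosen orientation.) *)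

(* Defs.v *)
From HB Require Import structures.
From Stdlib Require Import Relation_Operators.
From mathcomp Require Import all_boot all_order all_algebra.
From mathcomp Require Import boolp classical_sets functions cardinality fsbigop.

Set Implicit Arguments.
Unset Strict Implicit.
Unset Printing Implicit Defensive.

Local Open Scope classical_set_scope.
Local Open Scope ring_scope.

(* A graph (loops and parallel edges allowed) together with a fixed
   orientation: the edge [e] joins [src e] and [tgt e] and is directed from
   the former to the latter.  Only the flow condition uses the direction;
   adjacency, connectedness and bridges below are those of the underlying
   undirected graph. *)
Record graph := Graph {
  vertex : choiceType;
  edge : choiceType;
  src : edge -> vertex;
  tgt : edge -> vertex
}.

Section Graphs.
Variable G : graph.
Implicit Types (F : set (edge G)) (e : edge G) (u v : vertex G).

(* [F] is the edge set of a spanning subgraph of [G]. *)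
Definition adjacent_in F u v : Prop :=
  exists2 e, F e & (src e = u /\ tgt e = v) \/ (src e = v /\ tgt e = u).

Definition linked_in F : vertex G -> vertex G -> Prop :=
  clos_refl_trans (vertex G) (adjacent_in F).

Definition component_in F v : set (vertex G) := [set u | linked_in F v u].

Definition connected_in F : Prop := forall u v, linked_in F u v.

Definition connected_graph : Prop := connected_in [set: edge G].

Definition bridge e : Prop := ~ connected_in (~` [set e]).

Definition one_way_infinite_bridge e : Prop :=
  bridge e /\ exists v, finite_set (component_in (~` [set e]) v).

Definition locally_finite : Prop :=
  forall v, finite_set [set e | src e = v \/ tgt e = v].

Definition countably_infinite : Prop := ([set: vertex G] #= [set: nat])%card.

Definition out_edges v : set (edge G) := [set e | src e = v].
Definition in_edges v : set (edge G) := [set e | tgt e = v].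

(* [\sum_(e \in D) phi e] has the junk value 0 when [phi] has infinite support
   on [D]; this cannot happen in a locally finite graph. *)
Definition weak_flow (A : zmodType) (phi : edge G -> A) : Prop :=
  forall v, \sum_(e \in out_edges v) phi e = \sum_(e \in in_edges v) phi e.

Definition nowhere_zero (A : zmodType) (phi : edge G -> A) : Prop :=
  forall e, phi e != 0.

End Graphs.

(* Main.v *)
(* For a finite set S of vertices, contract all the other vertices of G to one
   vertex.  A bridge of the resulting finite multigraph would cut off a finite
   part of G, so it would be a one-way infinite bridge of G; hence the quotient
   is bridgeless, and Seymour's theorem gives it a nowhere-zero Z_6-flow.  This
   is a flow of G at the vertices of S, and a limit along an ultrafilter is a
   flow everywhere.

   Seymour's theorem is proved in terms of edge cuts.  An empty cut or a cut of
   size 2 is removed by identifying two vertices it separates.  If all nonempty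
   cuts have size at least 3, one grows a vertex set U carrying a Z_2-flow x2
   such that Z_3-valued functions on the edges inside U realize every zero-sum
   boundary while avoiding one forbidden value on each edge where x2 vanishes.
   To grow U, one attaches a set Y spanned by a connected even subgraph and
   joined to U by at least two edges.  Such a Y lies in a leaf of the
   decomposition of G - U along its bridges, by the edge version of Menger's
   theorem for two paths. *)
Require Import Defs.
From HB Require Import structures.
From mathcomp Require Import all_boot all_order all_algebra.
From mathcomp Require Import boolp zify.

Set Implicit Arguments.
Unset Strict Implicit.
Unset Printing Implicit Defensive.
Import GRing.Theory Num.Theory.
Local Open Scope ring_scope.

(** * Boundaries and cuts in finite oriented multigraphs *)

Section FiniteGraph.
Variables (V E : finType) (tl hd : E -> V).
Implicit Types (S T U Y L : {set V}).

(** Net outflow at [v]. A loop enters with both signs and contributes nothing. *)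
Definition bd (A : zmodType) (phi : E -> A) (v : V) : A :=
  \sum_e (phi e *+ (tl e == v) - phi e *+ (hd e == v)).

Definition inner S e := (tl e \in S) && (hd e \in S).
Definition cut S : {set E} := [set e | (tl e \in S) != (hd e \in S)].
Definition between S T : {set E} :=
  [set e | (tl e \in S) && (hd e \in T) || (tl e \in T) && (hd e \in S)].

Lemma bdD (A : zmodType) (phi psi : E -> A) v :
  bd (fun e => phi e + psi e) v = bd phi v + bd psi v.
Proof.
rewrite /bd -big_split /=; apply: eq_bigr => e _.
by rewrite !mulrnDl opprD addrACA.
Qed.

Lemma bd_sum (A : zmodType) (I : finType) (phi : I -> E -> A) (P : pred I) v :
  bd (fun e => \sum_(i | P i) phi i e) v = \sum_(i | P i) bd (phi i) v.
Proof.
rewrite /bd exchange_big /=; apply: eq_bigr => e _.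
by rewrite sumrB -!sumrMnl.
Qed.

Lemma bd_edge (A : zmodType) (c : A) e v :
  bd (fun e' => c *+ (e' == e)) v = c *+ (tl e == v) - c *+ (hd e == v).
Proof.
rewrite /bd (bigD1 e) //= eqxx big1 ?addr0 // => e' /negPf ->.
by rewrite !mul0rn subrr.
Qed.

Lemma sum_bd (A : zmodType) (phi : E -> A) S :
  \sum_(v in S) bd phi v =
  \sum_e (phi e *+ (tl e \in S) - phi e *+ (hd e \in S)).
Proof.
rewrite exchange_big /=; apply: eq_bigr => e _; rewrite sumrB.
have sum1 (x : V) : \sum_(v in S) phi e *+ (x == v) = phi e *+ (x \in S).
  rewrite sumrMnr; congr (_ *+ _).
  case: (boolP (x \in S)) => xS.
    rewrite (bigD1 x) //= eqxx big1 // => v /andP[_ nvx].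
    by rewrite eq_sym (negPf nvx).
  by rewrite big1 // => v vS; case: eqP xS => // ->; rewrite vS.
by rewrite !sum1.
Qed.

Lemma sum_bd0 (A : zmodType) (phi : E -> A) S :
  (forall e, phi e != 0 -> (tl e \in S) = (hd e \in S)) ->
  \sum_(v in S) bd phi v = 0.
Proof.
move=> phi0; rewrite sum_bd big1 // => e _.
have [->|/phi0 ->] := eqVneq (phi e) 0; first by rewrite !mul0rn subrr.
by rewrite subrr.
Qed.

Lemma bd_out (A : zmodType) (phi : E -> A) S v :
  (forall e, ~~ inner S e -> phi e = 0) -> v \notin S -> bd phi v = 0.
Proof.
move=> phi0 vS; rewrite /bd big1 // => e _.
case: (boolP (inner S e)) => [/andP[tS hS]|/phi0 ->]; last first.
  by rewrite !mul0rn subrr.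
have [tv|_] := eqVneq (tl e) v; first by rewrite -tv tS in vS.
have [hv|_] := eqVneq (hd e) v; first by rewrite -hv hS in vS.
by rewrite subrr.
Qed.

(** Equivalent to [Y] lying in one component of the spanning subgraph with edge set [C], phrased by
    cuts instead of paths. *)
Definition connects (C : pred E) Y : Prop :=
  forall S x y, x \in Y -> y \in Y -> x \in S -> y \notin S ->
  exists2 e, C e & e \in cut S.

(** Fix a root [a] in [Y]. Any amount can be routed through [C] from each vertex of [Y] to [a],
    because the vertices for which this is possible form a set closed under the edges of [C].
    Superposing routes of [beta y] from each [y] works, since the total arriving at [a] is 0. *)
Lemma connects_boundary (A : zmodType) (C : pred E) Y (beta : V -> A) :
  connects C Y -> \sum_(v in Y) beta v = 0 ->
  exists2 phi : E -> A, forall e, ~~ C e -> phi e = 0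
    & forall v, v \in Y -> bd phi v = beta v.
Proof.
move=> Ccon beta0.
have [->|[a aY]] := set_0Vmem Y.
  by exists (fun=> 0) => // v; rewrite inE.
pose reach y := forall c : A, exists phi : E -> A,
  (forall e, ~~ C e -> phi e = 0) /\
  forall v, bd phi v = c *+ (y == v) - c *+ (a == v).
have a_reach : a \in [set y | `[< reach y >]].
  rewrite inE; apply/asboolP => c; exists (fun=> 0); split=> // v.
  by rewrite /bd subrr big1 // => e _; rewrite !mul0rn subrr.
have reachY y : y \in Y -> reach y.
  move=> yY; apply: contrapT => nreach.
  have [|e Ce] := Ccon [set y | `[< reach y >]] a y aY yY a_reach.
    by rewrite inE; apply/asboolP.
  have ext (x z : V) :
      reach x -> (forall c : A, exists c', forall v,
        bd (fun e' => c' *+ (e' == e)) v = c *+ (z == v) - c *+ (x == v)) ->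
      reach z.
    move=> rx step c; have [phi [phi0 phib]] := rx c; have [c' stepc] := step c.
    exists (fun e' => c' *+ (e' == e) + phi e'); split=> [e' nC|v].
      by rewrite phi0 // addr0; case: eqP nC => // ->; rewrite Ce.
    by rewrite bdD stepc phib addrA subrK.
  rewrite !inE; case: asboolP => rt; case: asboolP => rh //= _.
    apply: rh; apply: (ext _ _ rt) => c; exists (- c) => v.
    by rewrite bd_edge !mulNrn opprK addrC.
  apply: rt; apply: (ext _ _ rh) => c; exists c => v.
  by rewrite bd_edge.
have /choice[phi phiP] y : exists f : E -> A, y \in Y ->
    (forall e, ~~ C e -> f e = 0) /\
    forall v, bd f v = beta y *+ (y == v) - beta y *+ (a == v).
  case: (boolP (y \in Y)) => yY; last by exists (fun=> 0).
  by have [phi ?] := reachY y yY (beta y); exists phi.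
exists (fun e => \sum_(y in Y) phi y e) => [e nC|v vY].
  by rewrite big1 // => y /phiP[->].
rewrite bd_sum (eq_bigr _ (fun y yY => (phiP y yY).2 v)) sumrB.
rewrite sumrMnl beta0 mul0rn subr0 (bigD1 v) //= eqxx big1 ?addr0 //.
by move=> y /andP[_ /negPf ->].
Qed.

(** * Unit-capacity flows and connected even subgraphs *)

(** Residual graph for capacity 1 in both directions: for [f] with values -1, 0, 1, a step is
    allowed when pushing one more unit along it keeps the value in that range. *)
Definition residual L (f : E -> int) : rel V := fun x y =>
  [exists e, inner L e && ((tl e == x) && (hd e == y) && (f e <= 0)
                        || (hd e == x) && (tl e == y) && (0 <= f e))].

Lemma residual_path_flow L (f : E -> int) x p :
    (forall e, `|f e| <= 1) -> path (residual L f) x p -> uniq (x :: p) ->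
  exists g : E -> int,
  [/\ forall v, bd g v = 1 *+ (x == v) - 1 *+ (last x p == v),
      forall e, g e != 0 -> [&& inner L e, tl e \in x :: p & hd e \in x :: p]
    & forall e, `|f e + g e| <= 1].
Proof.
move=> f1; elim: p x => [|y p IHp] x.
  move=> _ _; exists (fun=> 0); split=> [v|e|e]; rewrite ?eqxx ?addr0 //.
  by rewrite subrr /bd big1 // => e _; rewrite !mul0rn subrr.
case/andP=> /existsP[e /andP[eL res_e]] p_path /andP[x_p p_uniq].
have [g [bdg suppg fg1]] := IHp y p_path p_uniq.
(* The path is simple, so [x] lies off its remainder, while [g] lives on edges with both ends
   there. *)
have ge0 : g e = 0.
  apply: contraNeq x_p => /suppg/and3P[_ te he].
  by case/orP: res_e => /andP[/andP[/eqP<- _] _].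
pose c : int := if (tl e == x) && (hd e == y) && (f e <= 0) then 1 else -1.
exists (fun e' => c *+ (e' == e) + g e'); split=> [v|e'|e'].
- rewrite bdD bdg bd_edge /= addrA; congr (_ - _); rewrite /c.
  case: ifP res_e => [/andP[/andP[/eqP-> /eqP->] _] _|_ /= /andP[/andP[]]].
    by rewrite subrK.
  by move=> /eqP-> /eqP-> _; rewrite !mulNrn opprK addrC addrA subrr add0r.
- have [->{e'} _|ne] := eqVneq e' e.
    rewrite eL !inE; case/orP: res_e => /andP[/andP[/eqP-> /eqP->] _];
      by rewrite !eqxx !orbT.
  rewrite mulr0n add0r => /suppg/and3P[-> te he].
  by rewrite !(in_cons x) te he !orbT.
have [->{e'}|ne] := eqVneq e' e; last by rewrite mulr0n add0r.
rewrite ge0 mulr1n addr0 /c; have := f1 e; case: ifP res_e.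
  by case/andP=> _; lia.
by move=> _ /= /andP[_]; lia.
Qed.

(** A Ford-Fulkerson step. If no residual path reaches [b], every edge of [L] leaving the residually
    reachable set [R] carries a full unit outward. The net outflow [k] of [R] is then the size of
    its cut inside [L], which was assumed larger. *)
Lemma augment_flow L a b (f : E -> int) (k : nat) :
    a \in L -> (forall e, ~~ inner L e -> f e = 0) ->
    (forall e, `|f e| <= 1) ->
    (forall v, bd f v = k%:Z *+ (a == v) - k%:Z *+ (b == v)) ->
    (forall S, S \subset L -> a \in S -> b \notin S ->
      (k < #|between S (L :\: S)|)%N) ->
  exists f' : E -> int,
  [/\ forall e, ~~ inner L e -> f' e = 0, forall e, `|f' e| <= 1
    & forall v, bd f' v = k.+1%:Z *+ (a == v) - k.+1%:Z *+ (b == v)].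
Proof.
move=> aL f0 f1 bdf cutk.
case: (boolP (connect (residual L f) a b)) => [/connectP[p0 p0P defb]|nab].
  case/shortenP: p0P defb => p pP p_uniq _ defb.
  have [g [bdg suppg fg1]] := residual_path_flow f1 pP p_uniq.
  exists (fun e => f e + g e); split=> // [e nL|v].
    rewrite f0 // add0r; apply: contraNeq nL => /suppg/and3P[-> _ _].
    by [].
  by rewrite bdD bdf bdg -defb -addn1 PoszD !mulrnDl opprD addrACA.
pose R := [set x | connect (residual L f) a x].
have aR : a \in R by rewrite inE connect0.
have bR : b \notin R by rewrite inE.
have RL : R \subset L.
  apply/subsetP => x; rewrite inE => /connectP[p pP ->].
  elim: p a pP aL {f0 f1 bdf cutk nab R aR bR} => //= y p IHp x'.
  case/andP=> /existsP[e /andP[/andP[te he] res_e]] pP _; apply: IHp => //.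
  by case/orP: res_e => /andP[/andP[_ /eqP<-] _].
have stepR e : inner L e ->
    (tl e \in R -> f e <= 0 -> hd e \in R) *
    (hd e \in R -> 0 <= f e -> tl e \in R).
  move=> eL; split; rewrite !inE => con fe; apply: connect_trans con _;
    apply: connect1; apply/existsP; exists e; rewrite eL !eqxx fe ?orbT //.
have := cutk R RL aR bR.
have : \sum_(v in R) bd f v = k.
  rewrite (eq_bigr _ (fun v _ => bdf v)) sumrB (bigD1 a) //= eqxx.
  rewrite !big1 ?addr0 ?subr0 // => v.
    by move=> vR; case: eqP vR bR => // -> ->.
  by case/andP=> _ /negPf; rewrite eq_sym => ->.
suff -> : \sum_(v in R) bd f v = #|between R (L :\: R)|.
  by case=> ->; rewrite ltnn.
rewrite sum_bd -[RHS]natz -sum1_card natr_sum [RHS]big_mkcond /=.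
apply: eq_bigr => e _; rewrite !inE.
case: (boolP (inner L e)) => [eL|nL].
  have [st sh] := stepR e eL; have := f1 e.
  case/andP: eL => -> ->; move: st sh; rewrite !inE.
  case: (connect _ a (tl e)); case: (connect _ a (hd e)) => /= st sh f1e.
  - by rewrite subrr.
  - have := st isT; lia.
  - have := sh isT; lia.
  by rewrite subrr.
rewrite f0 // !mul0rn subrr; move: nL; rewrite /inner.
have := subsetP RL (tl e); have := subsetP RL (hd e).
rewrite !inE; case: (tl e \in L); case: (hd e \in L);
  case: (connect _ a (tl e)); case: (connect _ a (hd e)) => //= hL tL _;
  by [have := hL isT | have := tL isT].
Qed.

Lemma two_edge_connected_flow L a b :
    a \in L ->
    (forall S, S \subset L -> a \in S -> b \notin S ->
      (1 < #|between S (L :\: S)|)%N) ->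
  exists f : E -> int,
  [/\ forall e, ~~ inner L e -> f e = 0, forall e, `|f e| <= 1
    & forall v, bd f v = 2%:Z *+ (a == v) - 2%:Z *+ (b == v)].
Proof.
move=> aL cut2.
have [||||f [f0 f1 bdf]] := @augment_flow L a b (fun=> 0) 0 aL.
- by [].
- by [].
- by move=> v; rewrite /bd !mul0rn big1 // => e _; rewrite !mul0rn subrr.
- by move=> S SL aS bS; apply: ltnW; apply: cut2.
exact: (augment_flow aL f0 f1 bdf cut2).
Qed.

(** Take a flow of value 2 from [a] to [b] and let [Y] be the component of [a] in its support. Net
    outflow over [Y] vanishes, so [b] is in [Y]. All boundaries are even, so reducing the flow on
    [Y] mod 2 gives a [Z_2]-flow. *)
Lemma two_edge_connected_even L a b :
    a \in L ->
    (forall S, S \subset L -> a \in S -> b \notin S ->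
      (1 < #|between S (L :\: S)|)%N) ->
  exists Y (y2 : E -> 'Z_2),
  [/\ Y \subset L, (a \in Y) && (b \in Y),
      forall e, ~~ inner Y e -> y2 e = 0, forall v, bd y2 v = 0
    & connects (fun e => y2 e != 0) Y].
Proof.
move=> aL /(two_edge_connected_flow aL)[f [f0 f1 bdf]].
pose closed (S : {set V}) :=
  (a \in S) && [forall e, (f e != 0) ==> ((tl e \in S) == (hd e \in S))].
have closedP S e : closed S -> f e != 0 -> (tl e \in S) = (hd e \in S).
  by case/andP=> _ /forallP/(_ e)/implyP fS /fS/eqP.
have closedL : closed L.
  rewrite /closed aL; apply/forallP => e; apply/implyP => fe.
  suff /andP[-> ->] : inner L e by [].
  by apply: contraNT fe => /f0 ->.
have [Y /minsetP[Ycl Ymin] YL] := minset_exists closedL.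
have aY : a \in Y by case/andP: Ycl.
have fY e : f e != 0 -> (tl e \in Y) = (hd e \in Y) by apply: closedP.
have bY : b \in Y.
  have := sum_bd0 fY; rewrite (eq_bigr _ (fun v _ => bdf v)) sumrB.
  rewrite (bigD1 a) //= eqxx big1 => [|v /andP[_ /negPf]]; last first.
    by rewrite eq_sym => ->.
  apply: contraPT => bY; rewrite big1 ?subr0 ?addr0 // => v vY.
  by case: eqP vY bY => // -> ->.
pose y (e : E) : int := f e *+ (tl e \in Y).
have bdy v : bd y v = bd f v *+ (v \in Y).
  rewrite /bd -sumrMnl; apply: eq_bigr => e _; rewrite /y mulrnBl.
  have [->|/fY fYe] := eqVneq (f e) 0; first by rewrite !mul0rn.
  congr (_ - _).
    by case: eqP => [<-|_]; rewrite ?mulr0n ?mul0rn ?mulr1n.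
  by rewrite fYe; case: eqP => [<-|_]; rewrite ?mulr0n ?mul0rn ?mulr1n.
exists Y, (fun e => (y e)%:~R); split; rewrite ?aY ?bY //.
- move=> e; rewrite /inner /y; have [->|/fY ->] := eqVneq (f e) 0.
    by rewrite mul0rn.
  by rewrite andbb => /negPf ->.
- move=> v.
  have -> : bd (fun e => (y e)%:~R) v = (bd y v)%:~R :> 'Z_2.
    rewrite /bd rmorph_sum /=; apply: eq_bigr => e _.
    by rewrite rmorphB !rmorphMn.
  rewrite bdy bdf; case: (v \in Y); case: (a == v); case: (b == v) => //=;
    exact/eqP.
move=> S x z xY zY xS zS; apply: contrapT => noe.
(* The values of [f] are -1, 0, 1, so a nonzero value stays nonzero mod 2. *)
have {}noe e : f e != 0 -> tl e \in Y -> (tl e \in S) = (hd e \in S).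
  move=> fe te; apply: contrapT => /eqP ncut; apply: noe; exists e.
    rewrite /y te mulr1n; have := f1 e; move: fe.
    by case: (f e) => [[|[|?]]|[|?]].
  by rewrite inE.
(* The part of [Y] on the side of [S] containing [a] is closed, hence all of [Y] by minimality; but
   it misses [z] or [x]. *)
have half (T : {set V}) : (T = S) \/ (T = ~: S) -> closed (Y :&: T) \/ a \notin T.
  move=> defT; case: (boolP (a \in T)) => aT; [left|by right].
  rewrite /closed inE aY aT; apply/forallP => e; apply/implyP => fe.
  rewrite !inE -fY //; case: (boolP (tl e \in Y)) => //= tY.
  by case: defT => ->; rewrite ?inE noe.
case: (boolP (a \in S)) => aS.
  have [Scl|] := half S (or_introl erefl); last by rewrite aS.
  have defY := Ymin _ Scl (subsetIl _ _).
  by move: zY; rewrite -defY inE (negPf zS) andbF.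
have [Scl|] := half (~: S) (or_intror erefl); last by rewrite inE aS.
have defY := Ymin _ Scl (subsetIl _ _).
by move: xY; rewrite -defY !inE xS andbF.
Qed.

(** * Growing the vertex set in Seymour's theorem *)

(* [L] is a leaf of the bridge decomposition of [~: U], taken minimal among the
   sets with an edge to [U]; [root] is the end in [L] of an edge leaving to [U]. *)
Lemma even_attachment U :
    (forall S, cut S = set0 \/ (2 < #|cut S|)%N) -> cut U != set0 ->
  exists Y (y2 : E -> 'Z_2) e1 e2,
  [/\ [disjoint U & Y], [/\ e1 != e2, e1 \in between U Y & e2 \in between U Y],
      forall e, ~~ inner Y e -> y2 e = 0, forall v, bd y2 v = 0
    & connects (fun e => y2 e != 0) Y].
Proof.
move=> cut3 cutU.
pose leaf (L : {set V}) := [&& L \subset ~: U, between L U != set0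
  & (#|between L (~: U :\: L)| <= 1)%N].
have leafW : leaf (~: U).
  rewrite /leaf subxx (_ : between (~: U) U = cut U); last first.
    by apply/setP => e; rewrite !inE; case: (_ \in U); case: (_ \in U).
  rewrite cutU (_ : between _ _ = set0) ?cards0 //.
  by apply/setP => e; rewrite !inE !andNb !andbF.
have [L /minsetP[/and3P[LU LUe leafL] Lmin] _] := minset_exists leafW.
have LnU x : x \in L -> x \notin U.
  by move/(subsetP LU); rewrite inE.
(* The cut of [L] has at least 3 edges, and at most one of them avoids [U]. *)
have LU2 : (1 < #|between L U|)%N.
  have cutL : cut L = between L U :|: between L (~: U :\: L).
    apply/setP => e; rewrite !inE.
    have := LnU (tl e); have := LnU (hd e).
    by case: (tl e \in L); case: (hd e \in L); case: (tl e \in U);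
      case: (hd e \in U) => //= h1 h2; have := h1 isT; have := h2 isT.
  have [cutL0|] := cut3 L.
    by move: LUe; rewrite -subset0 -cutL0 cutL subsetUl.
  rewrite cutL => /leq_trans/(_ (leq_card_setU _ _)).
  by move: leafL; lia.
have /card_gt1P[e1 [e2 [e1LU e2LU ne12]]] := LU2.
pose root e := if tl e \in L then tl e else hd e.
have rootL e : e \in between L U -> root e \in L.
  by rewrite inE /root; case tL: (tl e \in L) => //= /andP[].
have root_between e (Y : {set V}) : e \in between L U -> root e \in Y ->
    e \in between U Y.
  rewrite !inE /root; case tL: (tl e \in L) => /=.
    by rewrite (negPf (LnU _ tL)) /= orbF => -> ->.
  by case/andP=> -> _ ->.
have [|Y [y2 [YL /andP[aY bY] y20 bdy2 Ycon]]] :=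
    @two_edge_connected_even L (root e1) (root e2) (rootL _ e1LU).
  (* Suppose at most one edge joins [S] to [L :\: S]. Both sets have an edge to [U], so by
     minimality of [L] each sends at least 2 edges to the rest of [~: U]. These 4 or more edge-ends
     exceed the available 3: one edge leaving [L], and one inside counted twice. *)
  move=> S SL aS bS; rewrite ltnNge; apply/negP => btw1.
  have sub_count T e : T \subset L -> T != L -> e \in between L U ->
      root e \in T -> (1 < #|between T (~: U :\: T)|)%N.
    move=> TL nTL eLU eT; rewrite ltnNge; apply: contra nTL => leafT.
    apply/eqP; apply: Lmin => //.
    rewrite /leaf (subset_trans TL LU) leafT andbT /=.
    apply/set0Pn; exists e; have := root_between e T eLU eT.
    by rewrite !inE orbC.
  have := sub_count S e1 SL _ e1LU aS.
  have := sub_count (L :\: S) e2 (subsetDl _ _) _ e2LU _.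
  have -> : S != L by apply: contraNneq bS => ->; apply: rootL.
  have -> : L :\: S != L.
    apply: contraTneq aS => defL; have := rootL _ e1LU.
    by rewrite -{1}defL inE => /andP[].
  rewrite inE bS rootL // => /(_ isT isT) cutT /(_ isT) cutS.
  have : (#|between S (~: U :\: S)| + #|between (L :\: S) (~: U :\: (L :\: S))|
      <= #|between L (~: U :\: L)| + (#|between S (L :\: S)|).*2)%N.
    rewrite -!sum1_card !(big_mkcond (fun e => e \in _)) /= -addnn -!big_split /=.
    apply: leq_sum => e _; rewrite !inE.
    have := subsetP SL (tl e); have := subsetP SL (hd e).
    have := LnU (tl e); have := LnU (hd e).
    case: (tl e \in S); case: (hd e \in S);
    case: (tl e \in L); case: (hd e \in L);
    case: (tl e \in U); case: (hd e \in U) => //= h1 h2 h3 h4;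
      by [have := h1 isT|have := h2 isT|have := h3 isT|have := h4 isT].
  by move: leafL cutS cutT btw1; lia.
exists Y, y2, e1, e2; split=> //.
  rewrite disjoint_sym disjoints_subset.
  exact: subset_trans YL LU.
by split=> //; apply: root_between.
Qed.

(* Z_3 is large enough to avoid the forbidden value [t e] on every edge outside
   the support of [x2] while meeting any prescribed boundary. *)
Definition avoiding U (x2 : E -> 'Z_2) : Prop :=
  forall (t : E -> 'Z_3) (beta : V -> 'Z_3), \sum_(v in U) beta v = 0 ->
  exists phi : E -> 'Z_3,
  [/\ forall e, ~~ inner U e -> phi e = 0,
      forall v, v \in U -> bd phi v = beta v
    & forall e, inner U e -> x2 e = 0 -> phi e != t e].

Lemma avoiding_set1 u : avoiding [set u] (fun=> 0).
Proof.
move=> t beta; rewrite big_set1 => beta0.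
(* Edges inside a single vertex are loops, so their values are free and [t e + 1] avoids [t e]. *)
exists (fun e => if inner [set u] e then t e + 1 else 0); split=> [e|v|e ->].
- by move/negPf->.
- rewrite inE => /eqP->; rewrite beta0 /bd big1 // => e _; rewrite /inner !inE.
  by case: ifP => [/andP[-> ->]|_]; rewrite ?mul0rn subrr.
by move=> _; rewrite -subr_eq0 addrC addKr.
Qed.

(** Start from [t e + 1] on all edges within [U :|: Y] but not inside [U]. Raising the values on
    [e1] and [e2] by 0 or 1 keeps them allowed and adjusts the net outflow of [Y]. The boundary on
    [Y] is then corrected along the support of [y2], where nothing is forbidden, and the property of
    [U] settles the boundary on [U]. *)
Lemma avoiding_setU U Y (x2 y2 : E -> 'Z_2) e1 e2 :
    avoiding U x2 -> [disjoint U & Y] ->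
    e1 != e2 -> e1 \in between U Y -> e2 \in between U Y ->
    (forall e, ~~ inner U e -> x2 e = 0) ->
    (forall e, ~~ inner Y e -> y2 e = 0) ->
    connects (fun e => y2 e != 0) Y ->
  avoiding (U :|: Y) (fun e => x2 e + y2 e).
Proof.
move=> Uav disUY ne12 e1UY e2UY x20 y20 Ycon t beta beta0.
have UnY x : x \in U -> x \notin Y by move=> xU; rewrite (disjointFr disUY xU).
pose psi0 e := if (e \in between U Y) || inner Y e then t e + 1 else 0 : 'Z_3.
pose shift (b1 b2 : bool) e : 'Z_3 := b1%:R *+ (e == e1) + b2%:R *+ (e == e2).
have [b1 [b2 sum_psi]] : exists b1 b2 : bool,
    \sum_(v in Y) bd (fun e => psi0 e + shift b1 b2 e) v =
    \sum_(v in Y) beta v.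
  have sumY b1 b2 : \sum_(v in Y) bd (fun e => psi0 e + shift b1 b2 e) v =
      \sum_(v in Y) bd psi0 v
      + (b1%:R *+ (tl e1 \in Y) - b1%:R *+ (hd e1 \in Y))
      + (b2%:R *+ (tl e2 \in Y) - b2%:R *+ (hd e2 \in Y)).
    rewrite (eq_bigr _ (fun v _ => bdD psi0 (shift b1 b2) v)) big_split /=.
    rewrite -addrA; congr (_ + _).
    rewrite (eq_bigr _ (fun v _ => bdD _ _ v)) big_split /=.
    congr (_ + _); rewrite sum_bd; [rewrite (bigD1 e1)|rewrite (bigD1 e2)] => //=;
      rewrite eqxx big1 ?addr0 // => e /negPf ->; by rewrite !mul0rn subrr.
  have ends e : e \in between U Y -> (tl e \in Y) = ~~ (hd e \in Y).
    rewrite inE; have := UnY (tl e); have := UnY (hd e).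
    case: (tl e \in U); case: (hd e \in U);
    case: (tl e \in Y); case: (hd e \in Y) => //= h1 h2;
      by [have := h1 isT|have := h2 isT].
  (* Two independent choices, each from 0 and one fixed sign, sum to every element of [Z_3]. *)
  have covers (s1 s2 : bool) (c d : 'Z_3) : exists b1 b2 : bool,
      c + (b1%:R *+ ~~ s1 - b1%:R *+ s1) + (b2%:R *+ ~~ s2 - b2%:R *+ s2) = d.
    suff /existsP[b1 /existsP[b2 /eqP ?]] : [exists b1 : bool, exists b2 : bool,
        c + (b1%:R *+ ~~ s1 - b1%:R *+ s1) + (b2%:R *+ ~~ s2 - b2%:R *+ s2) == d].
      by exists b1, b2.
    apply/existsP.
    case: c => [[|[|[|c]]] c3] //; case: d => [[|[|[|d]]] d3] //;
    case: s1; case: s2;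
    by [exists false; apply/existsP; exists false
       |exists false; apply/existsP; exists true
       |exists true; apply/existsP; exists false
       |exists true; apply/existsP; exists true].
  have [b1 [b2 eqb]] := covers (hd e1 \in Y) (hd e2 \in Y)
    (\sum_(v in Y) bd psi0 v) (\sum_(v in Y) beta v).
  by exists b1, b2; rewrite sumY !ends.
pose psi e := psi0 e + shift b1 b2 e.
have psi0t e : (e \in between U Y) || inner Y e -> psi e != t e.
  rewrite /psi /psi0 /shift => ->; rewrite -subr_eq0 addrAC [t e + 1]addrC addrK.
  have [-> |_] := eqVneq e e1.
    by rewrite (negPf ne12) mulr0n addr0; case: b1 {sum_psi psi}.
  by rewrite mulr0n add0r; case: (e == e2); case: b2 {sum_psi psi}.
have psi_out e : ~~ ((e \in between U Y) || inner Y e) -> psi e = 0.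
  rewrite negb_or /psi /psi0 /shift => /andP[nb ni].
  rewrite (negPf nb) (negPf ni) /=.
  have neb e' : e' \in between U Y -> (e == e') = false.
    by move=> e'b; apply: contraNF nb => /eqP->.
  by rewrite !neb // !mulr0n !addr0.
have [|phiY phiY0 bdY] :=
    @connects_boundary _ _ Y (fun v => beta v - bd psi v) Ycon.
  by rewrite sumrB sum_psi subrr.
have {}phiY0 e : y2 e = 0 -> phiY e = 0 by move=> y0; apply: phiY0; rewrite y0 eqxx.
pose rho e := psi e + phiY e.
have rho_in e : rho e != 0 -> inner (U :|: Y) e && ~~ inner U e.
  apply: contraNT; rewrite /inner !inE => ne.
  have UtY := UnY (tl e); have UhY := UnY (hd e).
  rewrite /rho psi_out ?phiY0 ?addr0 ?y20 // /inner ?inE; move: ne UtY UhY;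
    by case: (tl e \in U); case: (hd e \in U);
       case: (tl e \in Y); case: (hd e \in Y) => //= _ h1 h2;
       by [have := h1 isT|have := h2 isT].
have bd_rhoY v : v \in Y -> bd rho v = beta v.
  by move=> vY; rewrite bdD bdY // addrC subrK.
(* [rho] lives inside [U :|: Y], so its boundary sums to 0 there, as [beta] does; on [Y] the two
   agree. *)
have sumU : \sum_(v in U) (beta v - bd rho v) = 0.
  have : \sum_(v in U :|: Y) (beta v - bd rho v) = 0.
    rewrite sumrB beta0 sum_bd0 ?subr0 // => e /rho_in/andP[/andP[-> ->]] //.
  rewrite (eq_bigl _ _ (fun v => in_setU v U Y)) bigU //=.
  rewrite [X in _ + X = _ -> _]big1 ?addr0 // => v vY.
  by rewrite bd_rhoY ?subrr.
have [phiU [phiU0 bdU avU]] := Uav t _ sumU.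
exists (fun e => rho e + phiU e); split=> [e nUY|v|e eUY].
- rewrite phiU0 ?addr0.
    by apply/eqP; apply: contraNT nUY => /rho_in/andP[].
  by apply: contra nUY; rewrite /inner !inE => /andP[-> ->].
- rewrite bdD inE; case: (boolP (v \in U)) => [vU _|vU /= vY].
    by rewrite bdU // addrC subrK.
  by rewrite (bd_out phiU0 vU) addr0 bd_rhoY.
case: (boolP (inner U e)) => [eU|nU].
  have nY : ~~ inner Y e by case/andP: eU => tU _; rewrite /inner (negPf (UnY _ tU)).
  rewrite y20 // addr0 => x0.
  have -> : rho e = 0.
    by apply/eqP; apply: contraTT eU => /rho_in/andP[].
  by rewrite add0r; apply: avU.
rewrite x20 // add0r => /phiY0 pY0; rewrite phiU0 // /rho pY0 !addr0.
apply: psi0t; move: eUY nU; rewrite /inner !inE.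
by case: (tl e \in U); case: (hd e \in U); case: (tl e \in Y); case: (hd e \in Y).
Qed.

(** A maximal good set [U] has empty cut, since otherwise an even attachment would enlarge it. As
    [U] contains an end of [e0], the second hypothesis puts every edge inside [U]. *)
Lemma flow_Z2_Z3 :
    (forall S, cut S = set0 \/ (2 < #|cut S|)%N) ->
    (forall S, cut S = set0 ->
      (forall e, inner S e) \/ (forall e, tl e \notin S)) ->
  exists (x2 : E -> 'Z_2) (x3 : E -> 'Z_3),
  [/\ forall v, bd x2 v = 0, forall v, bd x3 v = 0
    & forall e, (x2 e != 0) || (x3 e != 0)].
Proof.
move=> cut3 cut_conn; have [E0|[e0 _]] := set_0Vmem [set: E].
  have noE (e : E) : False by have := in_setT e; rewrite E0 inE.
  by exists (fun=> 0), (fun=> 0); split=> [v|v|e]; try case: (noE e);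
    rewrite /bd big1 // => e; case: (noE e).
pose good U := tl e0 \in U /\ exists x2 : E -> 'Z_2,
  [/\ forall e, ~~ inner U e -> x2 e = 0, forall v, bd x2 v = 0 & avoiding U x2].
have good1 : `[< good [set tl e0] >].
  apply/asboolP; split; first by rewrite inE.
  exists (fun=> 0); split=> //; last exact: avoiding_set1.
  by move=> v; rewrite /bd big1 // => e _; rewrite !mul0rn subrr.
have [U /maxsetP[/asboolP[e0U [x2 [x20 bdx2 Uav]]] Umax] _] :=
  maxset_exists (good1 : (fun S => `[< good S >]) [set tl e0]).
have all_in : forall e, inner U e.
  have [cutU|cutU] := eqVneq (cut U) set0.
    by have [//|/(_ e0)] := cut_conn U cutU; rewrite e0U.
  have [Y [y2 [e1 [e2 [disUY [ne12 e1b e2b] y20 bdy2 Ycon]]]]] :=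
    even_attachment cut3 cutU.
  have : U :|: Y = U.
    apply: Umax (subsetUl _ _); apply/asboolP; split.
      by rewrite inE e0U.
    exists (fun e => x2 e + y2 e); split=> [e nUY|v|].
    - rewrite x20 ?y20 ?addr0 //; apply: contra nUY; rewrite /inner !inE;
        by case/andP=> -> ->; rewrite ?orbT.
    - by rewrite bdD bdx2 bdy2 addr0.
    exact: avoiding_setU Uav disUY ne12 e1b e2b x20 y20 Ycon.
  move/setUidPl => YU; exfalso; move: e1b; rewrite inE.
  have YU0 y : y \in Y -> False.
    move=> yY; have := subsetP YU y yY.
    by rewrite (disjointFl disUY yY).
  by case/orP=> /andP[h1 h2]; [apply: YU0 h2|apply: YU0 h1].
(* Forbidding the value 0 makes [x3] nonzero wherever [x2] vanishes. *)
have [|x3 [x30 bdx3 x3P]] := Uav (fun=> 0) (fun=> 0); first by rewrite big1.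
exists x2, x3; split=> // [v|e].
  case: (boolP (v \in U)) => [/bdx3 //|]; exact: bd_out.
by have [/x3P -> //|//] := eqVneq (x2 e) 0.
Qed.

End FiniteGraph.

(** * Combining the two flows and removing small cuts *)

Lemma bd_morph (V E : finType) (tl hd : E -> V) (A B : zmodType) (h : A -> B)
    (phi : E -> A) v :
  {morph h : x y / x - y} -> bd tl hd (h \o phi) v = h (bd tl hd phi v).
Proof.
move=> hB; have h0 : h 0 = 0 by rewrite -(subrr 0) hB subrr.
have hN x : h (- x) = - h x by rewrite -[- x]add0r hB h0 add0r.
have hD x y : h (x + y) = h x + h y by rewrite -{1}[y]opprK hB hN opprK.
rewrite /bd (big_morph h hD h0); apply: eq_bigr => e _ /=; rewrite hB.
by case: (tl e == v); case: (hd e == v); rewrite ?h0.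
Qed.

Lemma flow_Z6_of_Z2_Z3 (V E : finType) (tl hd : E -> V) (x2 : E -> 'Z_2) (x3 : E -> 'Z_3) :
    (forall v, bd tl hd x2 v = 0) -> (forall v, bd tl hd x3 v = 0) ->
    (forall e, (x2 e != 0) || (x3 e != 0)) ->
  exists phi : E -> 'Z_6,
    (forall v, bd tl hd phi v = 0) /\ (forall e, phi e != 0).
Proof.
move=> bdx2 bdx3 nz.
(* Embeddings onto the subgroups {0, 3} and {0, 2, 4} of [Z_6], which meet only in 0. *)
pose h2 (x : 'Z_2) : 'Z_6 := (x * 3)%:R; pose h3 (x : 'Z_3) : 'Z_6 := (x * 2)%:R.
have h2B : {morph h2 : x y / x - y}.
  by case=> [[|[|x]] xP] // [[|[|y]] yP] //; apply/eqP.
have h3B : {morph h3 : x y / x - y}.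
  by case=> [[|[|[|x]]] xP] // [[|[|[|y]]] yP] //; apply/eqP.
exists (fun e => (h2 \o x2) e + (h3 \o x3) e); split=> [v|e].
  rewrite bdD (bd_morph _ _ _ _ h2B) (bd_morph _ _ _ _ h3B) bdx2 bdx3.
  by apply/eqP.
move: (nz e) => /=.
by case: (x2 e) => [[|[|x]] xP] //; case: (x3 e) => [[|[|[|y]]] yP].
Qed.

(** Its size is the induction measure: identifying [y] with [x] keeps the type [V] but leaves [y]
    isolated. *)
Definition used (V E : finType) (tl hd : E -> V) : {set V} :=
  [set v | [exists e, (tl e == v) || (hd e == v)]].

Lemma bd_loop (V E : finType) (tl hd : E -> V) (A : zmodType)
    (phi psi : E -> A) v :
    (forall e, phi e != psi e -> tl e = hd e) ->
  bd tl hd phi v = bd tl hd psi v.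
Proof.
move=> loop; apply: eq_bigr => e _.
by have [->//|/loop ->] := eqVneq (phi e) (psi e); rewrite !subrr.
Qed.

Definition identify (V : eqType) (x y z : V) := if z == y then x else z.

(** A flow of the quotient has zero boundary away from [x] and [y], and opposite boundaries at these
    two. The sum over [S] isolates the boundary at [x], so both vanish. *)
Lemma identify_flow (V E : finType) (tl hd : E -> V) (A : zmodType)
    (phi : E -> A) (x y : V) (S : {set V}) :
    (forall v, bd (identify x y \o tl) (identify x y \o hd) phi v = 0) ->
    x \in S -> y \notin S -> \sum_(v in S) bd tl hd phi v = 0 ->
  forall v, bd tl hd phi v = 0.
Proof.
set p := identify x y => bd0 xS yS sumS.
have nxy : x != y by apply: contraNneq yS => <-.
have bdp v : bd (p \o tl) (p \o hd) phi v = \sum_(z | p z == v) bd tl hd phi z.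
  rewrite exchange_big /=; apply: eq_bigr => e _; rewrite sumrB.
  have sum1 (z : V) : \sum_(i | p i == v) phi e *+ (z == i) = phi e *+ (p z == v).
    have [pz|pz] := eqVneq (p z) v.
      rewrite (bigD1 z) ?pz //= eqxx big1 ?addr0 // => i /andP[_ /negPf].
      by rewrite eq_sym => ->.
    by rewrite big1 // => i /eqP pi; case: (eqVneq z i) pz => // ->; rewrite pi eqxx.
  by rewrite !sum1.
have bdo v : v != x -> v != y -> bd tl hd phi v = 0.
  move=> nvx nvy; rewrite -(bd0 v) bdp (bigD1 v) /=; last first.
    by rewrite /p /identify (negPf nvy).
  rewrite big1 ?addr0 // => z /andP[+ nzv]; rewrite /p /identify.
  case: (z == y); first by rewrite eq_sym (negPf nvx).
  by rewrite (negPf nzv).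
have bdx : bd tl hd phi x = 0.
  rewrite -sumS (bigD1 x) //= big1 ?addr0 // => v /andP[vS nvx].
  by apply: bdo => //; apply: contraNneq yS => <-.
move=> v; have [->//|nvx] := eqVneq v x.
have [->{v nvx}|nvy] := eqVneq v y; last exact: bdo.
rewrite -(bd0 x) bdp (bigD1 x) /=; last first.
  by rewrite /p /identify (negPf nxy).
rewrite bdx add0r (bigD1 y) /=; last first.
  by rewrite /p /identify eqxx eqxx eq_sym.
rewrite big1 ?addr0 // => z /andP[/andP[_ nzx] nzy]; exact: bdo.
Qed.

Lemma six_flow_finite (V E : finType) (tl hd : E -> V) :
    (forall S : {set V}, #|cut tl hd S| != 1%N) ->
  exists phi : E -> 'Z_6,
    (forall v, bd tl hd phi v = 0) /\ (forall e, phi e != 0).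
Proof.
have [n] := ubnP #|used tl hd|; elim: n tl hd => // n IHn tl hd used_n bridgeless.
have usedl e : tl e \in used tl hd by rewrite inE; apply/existsP; exists e; rewrite eqxx.
have usedr e : hd e \in used tl hd.
  by rewrite inE; apply/existsP; exists e; rewrite eqxx orbT.
have IH x y : x != y -> x \in used tl hd -> y \in used tl hd ->
    exists phi : E -> 'Z_6,
    (forall v, bd (identify x y \o tl) (identify x y \o hd) phi v = 0) /\
    (forall e, phi e != 0).
  move=> nxy xu yu; apply: IHn.
    rewrite ltnS in used_n; apply: leq_trans used_n.
    rewrite [X in (_ < X)%N](cardsD1 y) yu add1n ltnS; apply: subset_leq_card.
    apply/subsetP => z; rewrite [in X in X -> _]inE => /existsP[e].
    rewrite /= /identify => /orP[] /eqP <-; case: eqVneq => [_|ne];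
      by rewrite in_setD1 ?nxy ?ne ?usedl ?usedr ?xu.
  (* Cuts of the quotient are cuts of the original graph, so none has size 1. *)
  move=> S; rewrite (_ : cut _ _ S = cut tl hd (identify x y @^-1: S)) //.
  by apply/setP => e; rewrite !inE.
have disconnected (S : {set V}) x y : cut tl hd S = set0 -> x \in S -> y \notin S ->
    x \in used tl hd -> y \in used tl hd ->
    exists phi : E -> 'Z_6,
    (forall v, bd tl hd phi v = 0) /\ (forall e, phi e != 0).
  move=> cut0 xS yS xu yu.
  have [|phi [bd0 nz]] := IH x y _ xu yu; first by apply: contraNneq yS => <-.
  exists phi; split=> //; apply: identify_flow bd0 xS yS _.
  apply: sum_bd0 => e _; apply/eqP; move/setP/(_ e): cut0; rewrite !inE.
  by move/negbFE.
have two_cut (S : {set V}) : #|cut tl hd S| = 2%N ->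
    exists phi : E -> 'Z_6,
    (forall v, bd tl hd phi v = 0) /\ (forall e, phi e != 0).
  move/eqP/cards2P => [e [f [nef cutef]]].
  have eC : e \in cut tl hd S by rewrite cutef !inE eqxx.
  have fC : f \in cut tl hd S by rewrite cutef !inE eqxx orbT.
  pose x := if tl e \in S then tl e else hd e.
  pose y := if tl e \in S then hd e else tl e.
  have [xS yS] : x \in S /\ y \notin S.
    by move: eC; rewrite /x /y inE; case tS: (tl e \in S); case hS: (hd e \in S);
      rewrite ?tS ?hS.
  have nxy : x != y by apply: contraNneq yS => <-.
  have [||phi [bd0 nz]] := IH x y nxy; rewrite ?/x ?/y; try by case: ifP.
  (* After the identification [e] is a loop, so its value is free. It is reset to [phi f] up to
     sign, hence nonzero, so that [e] and [f] cancel in the net outflow of [S]. *)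
  pose c := if (tl e \in S) == (tl f \in S) then - phi f else phi f.
  pose psi e' := if e' == e then c else phi e'.
  exists psi; split=> [|e']; last first.
    by rewrite /psi /c; do 2?case: ifP => _; rewrite ?oppr_eq0 nz.
  apply: (identify_flow _ xS yS).
    move=> v; rewrite -(bd0 v); apply: bd_loop => e'; rewrite /psi /=.
    case: (eqVneq e' e) => [-> _|_]; last by rewrite eqxx.
    rewrite /x /y /identify; case: (tl e \in S); rewrite ?eqxx; case: ifP => //.
  rewrite sum_bd (bigD1 e) //= (bigD1 f) 1?eq_sym //= big1; last first.
    move=> e' /andP[ne nf]; have : e' \notin cut tl hd S.
      by rewrite cutef !inE (negPf ne) (negPf nf).
    by rewrite inE => /negPn/eqP ->; rewrite subrr.
  move: eC fC; rewrite addr0 !inE /psi eqxx [f == e]eq_sym (negPf nef) /c.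
  case: (tl e \in S); case: (hd e \in S) => //=; case: (tl f \in S);
    by case: (hd f \in S) => //= _ _; rewrite ?sub0r ?subr0 ?opprK ?addNr ?subrr.
apply: contrapT => noflow.
have cut3 (S : {set V}) : cut tl hd S = set0 \/ (2 < #|cut tl hd S|)%N.
  case: (ltnP 2 #|cut tl hd S|) => [|cutS]; [by right|left].
  apply/eqP; rewrite -cards_eq0; move: cutS (bridgeless S).
  case defn: #|_| => [|[|[|m]]] // _ _.
  by case: noflow; apply: two_cut defn.
have [|x2 [x3 [bdx2 bdx3 nz]]] := flow_Z2_Z3 cut3; last first.
  by apply: noflow; apply: flow_Z6_of_Z2_Z3 nz.
(* An empty cut with edges on both sides is the disconnected case already treated. *)
move=> S cut0; apply: contrapT => /not_orP[/existsNP[e ne] /existsNP[f fS]].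
apply: noflow; apply: (disconnected S (tl f) (tl e)) => //.
  by apply/negP => nfS; apply: fS; apply/negP.
apply: contra_notN ne => eS; move/setP/(_ e): cut0; rewrite /inner !inE eS.
by case: (hd e \in S).
Qed.

(* Compactness: from finite quotients to the infinite graph *)
From mathcomp Require Import classical_sets functions cardinality fsbigop filter.
From mathcomp Require Import finmap.
Local Open Scope classical_set_scope.

(** If no fibre of [phi i x] over [i] were in [U], all their complements would be; there are
    finitely many and their intersection is empty. *)
Lemma ultrafilter_limit (I D : Type) (T : finType) (phi : I -> D -> T)
    (U : set_system I) :
  UltraFilter U -> exists psi : D -> T, forall x, U [set i | phi i x = psi x].
Proof.
move=> ultraU.
suff /choice[psi psiP] : forall x, exists c, U [set i | phi i x = c] by exists psi.
move=> x; apply: contrapT => /forallNP noc.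
have /filter_ex[i /(_ (phi i x))] : U [set i | forall c, phi i x <> c]; last by [].
apply: filter_forall => c.
by have [/noc|] := in_ultra_setVsetC [set i | phi i x = c] ultraU.
Qed.

Section Compactness.
Variables (G : graph) (rank : vertex G -> nat).
Hypothesis rank_inj : injective rank.
Hypothesis lfG : locally_finite G.
Hypothesis no_bridge : forall e : edge G, ~ one_way_infinite_bridge e.
Implicit Types (e : edge G) (v : vertex G).

Let incident v : set (edge G) := [set e | src e = v \/ tgt e = v].

Lemma finite_rank_lt n : finite_set [set v | (rank v < n)%N].
Proof.
by apply: (@finite_preimage _ _ `I_n rank) => // u v _ _; apply: rank_inj.
Qed.

(** No edge other than [e] leaves [T], so [T] is a union of components of the graph without [e]; the
    component of the end of [e] in [T] is therefore finite. *)
Lemma one_way_bridge_of_cut (T : set (vertex G)) e :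
    finite_set T -> T (src e) <> T (tgt e) ->
    (forall e', T (src e') <> T (tgt e') -> e' = e) ->
  one_way_infinite_bridge e.
Proof.
move=> Tfin eT only_e.
have linkT u v : linked_in (~` [set e]) u v -> T u = T v.
  elim=> {u v} [u v [e' ne' ends]|//|u v w _ -> _ -> //].
  have TT : T (src e') = T (tgt e') by apply: contrapT => /only_e.
  by case: ends => -[<- <-].
have compT u : T u -> component_in (~` [set e]) u `<=` T.
  by move=> Tu w /linkT <-.
split; first by move=> con; apply/eT/linkT/con.
case: (pselect (T (src e))) => [Ts|nTs].
  by exists (src e); apply: sub_finite_set Tfin; apply: compT.
exists (tgt e); apply: sub_finite_set Tfin; apply: compT.
by apply: contrapT => nTt; apply: eT; rewrite propeqE.
Qed.

(* Contracting the vertices of rank at least [n] to the single vertex [ord_max]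
   creates no bridge: a bridge of the quotient would cut off a finite set of
   vertices of [G]. *)
Lemma six_flow_below n : exists phi : edge G -> 'Z_6,
  (forall v, (rank v < n)%N ->
    \sum_(e \in out_edges v) phi e = \sum_(e \in in_edges v) phi e) /\
  nowhere_zero phi.
Proof.
have /finite_fsetP[X defX] :
    finite_set (\bigcup_(v in [set v | (rank v < n)%N]) incident v).
  by apply: bigcup_finite => [|v _]; [exact: finite_rank_lt|exact: lfG].
have memX e : (rank (src e) < n)%N || (rank (tgt e) < n)%N -> e \in X.
  move=> ltn; suff : [set` X] e by [].
  rewrite -defX; case/orP: ltn => ltn; [exists (src e)|exists (tgt e)] => //.
    by left.
  by right.
pose q v : 'I_n.+1 := inord (minn (rank v) n).
have qE v : q v = minn (rank v) n :> nat by rewrite inordK // ltnS geq_minr.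
pose tl (e : X) := q (src (val e)); pose hd (e : X) := q (tgt (val e)).
have bridgeless (S : {set 'I_n.+1}) : #|cut tl hd S| != 1%N.
  (* Complementing [S] keeps its cut. Once [S] misses the contracted vertex, its preimage in [G] is
     finite. *)
  wlog maxS : S / ord_max \notin S.
    move=> wlogS; case: (boolP (ord_max \in S)) => [maxS|/wlogS //].
    suff <- : cut tl hd (~: S)%SET = cut tl hd S by apply: wlogS; rewrite !inE negbK.
    by apply/setP => e; rewrite !inE; case: (_ \in S); case: (_ \in S).
  apply/negP => /cards1P[e cutS].
  have Tlt v : q v \in S -> (rank v < n)%N.
    move=> vS; rewrite ltnNge; apply: contra maxS => le_n_v.
    suff <- : q v = ord_max by [].
    by apply: val_inj; rewrite /= qE; apply/minn_idPr.
  have cutP e' : ([set v | q v \in S] (src e') <> [set v | q v \in S] (tgt e')) <->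
      (q (src e') \in S) != (q (tgt e') \in S).
    split=> /=; last by move=> + eq_S => /eqP; apply; apply/idP/idP; rewrite eq_S.
    by move=> neS; apply/eqP => eqS; apply: neS; rewrite eqS.
  apply: (@no_bridge (val e)).
  apply: (@one_way_bridge_of_cut [set v | q v \in S]).
  - by apply: sub_finite_set (finite_rank_lt n) => v /Tlt.
  - apply/cutP; have : e \in cut tl hd S by rewrite cutS inE.
    by rewrite inE.
  move=> e' /cutP e'S.
  have e'X : e' \in X.
    apply: memX; move: e'S; case: (boolP (q (src e') \in S)) => [/Tlt -> //|_].
    by case: (boolP (q (tgt e') \in S)) => [/Tlt ->|//]; rewrite orbT.
  have : [` e'X]%fset \in cut tl hd S by rewrite inE.
  by rewrite cutS inE => /eqP <-.
have [psi [bd0 nz]] := six_flow_finite bridgeless.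
(* Edges outside [X] have no end of rank below [n], so the default 1 affects none of the required
   sums and is nonzero. *)
pose phi e : 'Z_6 := if insub e is Some e' then psi e' else 1.
have phiE (e : X) : phi (val e) = psi e by rewrite /phi valK.
exists phi; split=> [v ltvn|e]; last first.
  by rewrite /phi; case: insub.
have sumE (h : edge G -> vertex G) (D : set (edge G)) :
    D = [set e | h e = v] -> (forall e, h e = v -> e \in X) ->
    \sum_(e \in D) phi e = \sum_(e : X) psi e *+ (q (h (val e)) == q v).
  move=> -> hX; rewrite (fsbigE [seq e <- X | h e == v]) ?filter_uniq //.
  - rewrite big_filter_cond.
    rewrite (eq_bigl (fun e => h e == v)) => [|e]; last first.
      by apply: andb_idr => /eqP hv; apply: mem_set.
    rewrite big_seq_fsetE big_mkcond; apply: eq_bigr => e _.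
    rewrite phiE; have -> : (q (h (val e)) == q v) = (h (val e) == v); last first.
      by case: eqP.
    (* A vertex of rank below [n] is alone in its class under [q]. *)
    apply/eqP/eqP => [/(congr1 val)|->//]; rewrite /= !qE.
    by move=> eqr; apply: rank_inj; move: ltvn eqr; lia.
  - by move=> e; rewrite /= mem_filter => /andP[/eqP].
  by move=> e hv; rewrite mem_filter (hX _ hv) andbT => /eqP.
apply/eqP; rewrite -subr_eq0 (sumE (@src G)) // ?(sumE (@tgt G)) //.
- rewrite -sumrB; apply/eqP; apply: bd0.
- by move=> e ev; apply: memX; rewrite ev ltvn orbT.
by move=> e ev; apply: memX; rewrite ev ltvn.
Qed.

Lemma locally_finite_six_flow :
  exists phi : edge G -> 'Z_6, weak_flow phi /\ nowhere_zero phi.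
Proof.
have [phi phiP] := choice six_flow_below.
have [U [ultraU leU]] := ultraFilterLemma eventually_filter.
have [psi psiP] := ultrafilter_limit phi ultraU.
exists psi; split=> [v|e]; last first.
  have [n <-] := filter_ex (psiP e); exact: (phiP n).2.
have /finite_fsetP[X defX] := lfG v.
(* [U] refines the cofinite filter and [v] has finitely many incident edges. Hence some [n] above
   [rank v] has [phi n] agreeing with [psi] on all of them, and the flow condition at [v]
   transfers. *)
have Ularge : U [set n | (rank v < n)%N] by apply: leU; exists (rank v).+1.
have Ueq : U (\bigcap_(e in [set` X]) [set n | phi n e = psi e]).
  by apply: filter_bigI => e _; apply: psiP.
have [n [ltvn eqn]] := filter_ex (filterI Ularge Ueq).
have {}eqn e : src e = v \/ tgt e = v -> psi e = phi n e.
  by move=> ev; rewrite -eqn // -defX.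
rewrite (eq_fsbigr (phi n)) => [|e]; last first.
  by move=> /set_mem ev; apply: eqn; left.
rewrite [RHS](eq_fsbigr (phi n)) => [|e]; last first.
  by move=> /set_mem ev; apply: eqn; right.
exact: (phiP n).1.
Qed.

End Compactness.

Theorem theorem2p4 (G : graph) :
  connected_graph G ->
  countably_infinite G ->
  locally_finite G ->
  (forall e : edge G, ~ one_way_infinite_bridge e) ->
  exists phi : edge G -> 'Z_6, weak_flow phi /\ nowhere_zero phi.
Proof.
move=> _ /card_set_bijP[rank [_ rank_inj _]].
apply: locally_finite_six_flow => u v; apply: rank_inj; exact: in_setT.
Qed.
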